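(* Let $G$ be a group and $A$ an abelian group, considered as a trivial $G$-module. The graded linear map $S^\bullet:C^\bullet(G,A)\to CR^\bullet(\mathrm{Conj}(G),A)$ given in degree $n$ by $$S^n(f)=\sum_{\sigma\in\mathbb{S}_n}\epsilon(\sigma)\,f\circ\lambda_n\circ\sigma^*\circ\theta\circ\mathrm{inc}_*\circ\eta_n^{-1}$$ is a morphism of cochain complexes from $\{C^n(G,A),d_G^n\}_{n\in\mathbb{N}}$ to $\{CR^n(\mathrm{Conj}(G),A),d_R^n\}_{n\in\mathbb{N}}$.
   Context: $\mathbb{N}=\{0,1,2,\dots\}$; $\mathbb{S}_n$ is the group of permutations of $\{1,\dots,n\}$ and $\epsilon$ the sign. $\mathrm{Conj}(G)$ is the rack with underlying set $G$ and $x\rhd y=xyx^{-1}$. Complexes (trivial coefficients). $C^n(G,A)$ and $CR^n(\mathrm{Conj}(G),A)$ are both the group of maps $G^n\to A$. $d_G^{n+1}f=\sum_{i=0}^{n+1}(-1)^i d_i^{n+1}f$ with $(d_0^{n+1}f)(x_1,\dots,x_{n+1})=f(x_2,\dots,x_{n+1})$, $(d_i^{n+1}f)(x_1,\dots,x_{n+1})=f(x_1,\dots,x_ix_{i+1},\dots,x_{n+1})$ for $1\le i\le n$, $(d_{n+1}^{n+1}f)(x_1,\dots,x_{n+1})=f(x_1,\dots,x_n)$. $d_R^{n+1}f=\sum_{i=1}^{n+1}(-1)^i(d_{i,0}^{n+1}f-d_{i,1}^{n+1}f)$ with $(d_{i,0}^{n+1}f)(x_1,\dots,x_{n+1})=f(x_1,\dots,x_{i-1},x_i\rhd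 x_{i+1},\dots,x_i\rhd x_{n+1})$ and $(d_{i,1}^{n+1}f)(x_1,\dots,x_{n+1})=f(x_1,\dots,x_{i-1},x_{i+1},\dots,x_{n+1})$. Trunks. For a directed graph with source $s$ and target $t$, let $\mathrm{S}$ be the set of quadruples $(a,b,c,d)$ of edges with $s(a)=s(c)$, $t(a)=s(b)$, $t(c)=s(d)$, $t(b)=t(d)$. A trunk is a directed graph with a subset of $\mathrm{S}$ of ''preferred squares''; a trunk map is a graph map sending preferred squares to preferred squares. The trunk $\square_n$ has as vertices the subsets of $\{1,\dots,n\}$, as edges the pairs $A\to A\amalg\{k\}$ ($k\notin A$), and as preferred squares $\big(A\to A\amalg\{k\},A\amalg\{k\}\to A\amalg\{k,l\},A\to A\amalg\{l\},A\amalg\{l\}\to A\amalg\{k,l\}\big)$ with $k<l$, $k,l\notin A$. The trunk of $\mathrm{Conj}(G)$, denoted $\mathrm{Conj}(G)$, has one vertex, edge set $G$ and preferred squares $(a,b,a\rhd b,a)$. $G_{\mathbf{Cat}}$ is the category with one object and morphisms the elements of $G$, where the composite of $a$ followed by $b$ is $ab$; $\mathrm{Tr}(G_{\mathbf{Cat}})$ is the trunk with one vertex, edge set $G$ and preferred squares the $(a,b,c,d)$ with $ab=cd$. Maps in the composition. - $\eta_n:\mathrm{Hom}_{\mathbf{Trunk}}(\square_n,\mathrm{Conj}(G))\to G^n$ is the bijection $F\mapsto(x_1,\dots,x_n)$, $x_k=F(\{1,\dots,k-1\}\to\{1,\dots,k\})$. - $\mathrm{inc}_*:\mathrm{Hom}_{\mathbf{Trunk}}(\square_n,\mathrm{Conj}(G))\to\mathrm{Hom}_{\mathbf{Trunk}}(\square_n,\mathrm{Tr}(G_{\mathbf{Cat}}))$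 is composition with the trunk map $\mathrm{inc}:\mathrm{Conj}(G)\to\mathrm{Tr}(G_{\mathbf{Cat}})$ which is the identity on edges. - $\theta:\mathrm{Hom}_{\mathbf{Trunk}}(\square_n,\mathrm{Tr}(G_{\mathbf{Cat}}))\to\mathrm{Hom}_{\mathbf{Cat}}(\square_n,G_{\mathbf{Cat}})$ is the bijection sending a trunk map to the unique functor with the same values on the morphisms $A\to A\amalg\{k\}$; here, in the target, $\square_n$ denotes the poset category of subsets of $\{1,\dots,n\}$ ordered by inclusion. (It comes from the adjunction between trunks and categories.) - $\sigma^*:\mathrm{Hom}_{\mathbf{Cat}}(\square_n,G_{\mathbf{Cat}})\to\mathrm{Hom}_{\mathbf{Cat}}(\Delta_n,G_{\mathbf{Cat}})$ is precomposition with the functor $\sigma:\Delta_n\to\square_n$, $\sigma(0)=\emptyset$, $\sigma(k)=\{\sigma(1),\dots,\sigma(k)\}$, where $\Delta_n$ is the poset category of $\{0<1<\dots<n\}$. - $\lambda_n:\mathrm{Hom}_{\mathbf{Cat}}(\Delta_n,G_{\mathbf{Cat}})\to G^n$ is the bijection $F\mapsto(F(0\to1),\dots,F(n-1\to n))$. *)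

(* Defs.v *)
From HB Require Import structures.
From mathcomp Require Import all_boot all_order all_algebra all_fingroup.
From mathcomp Require Import boolp functions.
From mathcomp Require Import zify.

Set Implicit Arguments.
Unset Strict Implicit.
Unset Printing Implicit Defensive.

Import GRing.Theory.
Local Open Scope ring_scope.

(* The index set {1,...,n} is 'I_n = {0,...,n-1}: the element k of             *)
(* {1,...,n} is the ordinal of value k-1.  Equality of maps, of trunk maps   *)
(* and of functors is Leibniz equality, by functional extensionality and      *)
(* proof irrelevance.                                                         *)

Record cochain_complex := CochainComplex {
  cochain :> nat -> zmodType;
  codiff : forall n, cochain n -> cochain n.+1;
  codiff_zmod : forall n, zmod_morphism (@codiff n);
  codiffK : forall n (f : cochain n), codiff (codiff f) = 0
}.
Arguments codiff C {n} : rename.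

Definition cochain_morphism (C D : cochain_complex)
    (phi : forall n, C n -> D n) : Prop :=
  (forall n, zmod_morphism (phi n)) /\
  (forall n (f : C n), phi n.+1 (codiff C f) = codiff D (phi n f)).

Lemma alt_sum_eq0 (A : zmodType) (m : nat) (a : nat -> nat -> A) :
  (forall i j, (i < j)%N -> (j < m.+1)%N -> a j i = a i j.-1) ->
  \sum_(j < m.+1) \sum_(i < m) a j i *~ (-1) ^+ (i + j) = 0.
Proof.
move=> aE; rewrite pair_big /=.
rewrite (bigID (fun p : 'I_m.+1 * 'I_m => (p.2 < p.1)%N)) /=.
set S1 := (X in X + _); set S2 := (X in _ + X).
suff -> : S1 = - S2 by rewrite addNr.
case: m => [|m] in a aE S1 S2 *.
  by rewrite /S1 /S2 !big1 ?oppr0 //; case=> i [k ltk] _; exfalso; move: ltk; rewrite ltn0.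
pose h (p : 'I_m.+2 * 'I_m.+1) : 'I_m.+2 * 'I_m.+1 :=
  (widen_ord (leqnSn _) p.2, inord p.1.-1).
pose h' (p : 'I_m.+2 * 'I_m.+1) : 'I_m.+2 * 'I_m.+1 :=
  (lift ord0 p.2, inord p.1).
have hK (p : 'I_m.+2 * 'I_m.+1) : ~~ (p.2 < p.1)%N -> h (h' p) = p.
  case: p => j i /= ij; have lti := ltn_ord i; rewrite /h /h' /=.
  by congr (_, _); apply: val_inj; rewrite /= /bump /= inordK //; lia.
have h'K (p : 'I_m.+2 * 'I_m.+1) : (p.2 < p.1)%N -> h' (h p) = p.
  case: p => j i /= ij; have ltj := ltn_ord j; rewrite /h /h' /=.
  by congr (_, _); apply: val_inj; rewrite /= /bump /= inordK //; lia.
have h'P (p : 'I_m.+2 * 'I_m.+1) : ~~ (p.2 < p.1)%N ->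
    [/\ (h' p).1 = p.2.+1 :> nat & (h' p).2 = p.1 :> nat].
  case: p => j i /= ij; have lti := ltn_ord i.
  by split; rewrite /= /bump /= ?inordK //; lia.
rewrite /S1 /S2 (reindex_onto h' h) /=; last by move=> p; apply: h'K.
rewrite -sumrN; apply: eq_big => [p|p /andP[lt_p /eqP hp]].
  apply/andP/idP => [[lt_p /eqP hp]|pP]; last first.
    have [E1 E2] := h'P _ pP; split; last by apply/eqP/hK.
    by rewrite -[X in (_ < X)%N]/(nat_of_ord (h' p).1) -/(h' p) E1 E2; lia.
  have e1 : nat_of_ord (h (h' p)).1 = p.1 by rewrite hp.
  by move: lt_p; rewrite /h /h' /= in e1 *; rewrite e1 /bump; lia.
have pP : ~~ (p.2 < p.1)%N.
  have e1 : nat_of_ord (h (h' p)).1 = p.1 by rewrite hp.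
  by move: lt_p; rewrite /h /h' /= in e1 *; rewrite e1 /bump; lia.
have [/= E1 E2] := h'P _ pP; rewrite E1 E2 aE //=; first last.
- by rewrite ltnS ltn_ord.
- by lia.
by rewrite -mulrNz; congr (_ *~ _); rewrite addnS exprS mulN1r addnC.
Qed.

Notation fpow X n := {ffun 'I_n -> X}.

(* [gface i] is the argument of [f] in the i-th summand of d_G, 0 <= i <= n+1; *)
(* for i = 0 the third branch applies everywhere, for i = n+1 the first.       *)
Definition gface (G : groupType) (n : nat) (i : nat) (x : fpow G n.+1) :
    fpow G n :=
  [ffun j : 'I_n =>
     if (j.+1 < i)%N then x (widen_ord (leqnSn n) j)
     else if j.+1 == i then (x (widen_ord (leqnSn n) j) * x (lift ord0 j))%g
     else x (lift ord0 j)].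

Definition group_codiff (G : groupType) (A : zmodType) (n : nat)
    (f : fpow G n -> A) : fpow G n.+1 -> A :=
  \sum_(i < n.+2) (f \o gface i) *~ (-1) ^+ i.

Lemma sumfE (I : Type) (T : Type) (A : zmodType) (r : seq I) (P : pred I)
  (F : I -> T -> A) (x : T) :
  (\sum_(i <- r | P i) F i) x = \sum_(i <- r | P i) F i x.
Proof. by rewrite fct_sumE. Qed.

Lemma mulrzfE (T : Type) (A : zmodType) (F : T -> A) (m : int) (x : T) :
  (F *~ m) x = F x *~ m.
Proof.
have natE k : (F *+ k) x = F x *+ k.
  by elim: k => [|k IH]; rewrite ?mulr0n // !mulrS -IH.
by case: m => k; rewrite ?NegzE ?mulrNz -!pmulrn -natE.
Qed.

Lemma group_codiffE (G : groupType) (A : zmodType) n (f : fpow G n -> A) x :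
  group_codiff f x = \sum_(i < n.+2) f (gface i x) *~ (-1) ^+ i.
Proof. by rewrite /group_codiff sumfE; apply: eq_bigr => i _; rewrite mulrzfE. Qed.

Lemma group_codiff_zmod (G : groupType) (A : zmodType) n :
  zmod_morphism (@group_codiff G A n).
Proof.
move=> f g; apply/funext => x.
rewrite [RHS]/= -[RHS]/(group_codiff f x - group_codiff g x) !group_codiffE.
by rewrite -sumrB; apply: eq_bigr => i _; rewrite -mulrzBl.
Qed.

Lemma ffun_eqval (X : Type) n (x : fpow X n) (u v : 'I_n) :
  u = v :> nat -> x u = x v.
Proof. by move=> /val_inj ->. Qed.

Lemma gface_gface (G : groupType) n i j (x : fpow G n.+2) :
  (i < j)%N -> (j < n.+3)%N -> gface i (gface j x) = gface j.-1 (gface i x).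
Proof.
case: j => // j; rewrite ltnS => ij jn; apply/ffunP => k; rewrite !ffunE /=.
rewrite /bump /= !add1n !eqSS !ltnS.
repeat case: ifP => //; intros; rewrite ?mulgA; try lia.
all: try by repeat congr (_ * _)%g; apply: ffun_eqval => /=; lia.
all: try by apply: ffun_eqval => /=; rewrite /bump; lia.
Qed.

Lemma group_codiffK (G : groupType) (A : zmodType) n (f : fpow G n -> A) :
  group_codiff (group_codiff f) = 0.
Proof.
apply/funext => x; rewrite group_codiffE.
rewrite -[RHS](@alt_sum_eq0 A n.+2 (fun j i => f (gface i (gface j x)))).
  apply: eq_bigr => j _; rewrite group_codiffE mulrz_suml.
  by apply: eq_bigr => i _; rewrite -mulrzA -exprD.
by move=> i j ij jn; rewrite gface_gface.
Qed.

Definition group_complex (G : groupType) (A : zmodType) : cochain_complex :=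
  @CochainComplex (fun n => (fpow G n -> A) : zmodType)
    (@group_codiff G A) (@group_codiff_zmod G A) (@group_codiffK G A).

Record rack := Rack {
  rack_sort :> Type;
  rack_op : rack_sort -> rack_sort -> rack_sort;
  rack_op_bij : forall x, bijective (rack_op x);
  rack_op_distr : forall x y z,
    rack_op x (rack_op y z) = rack_op (rack_op x y) (rack_op x z)
}.

Declare Scope rack_scope.
Delimit Scope rack_scope with rack.
Local Open Scope rack_scope.
Notation "x |> y" := (rack_op x y) (at level 40, left associativity) : rack_scope.

Definition conj_op (G : groupType) (x y : G) : G := (x * y * x^-1)%g.

Lemma conj_op_bij (G : groupType) (x : G) : bijective (conj_op x).
Proof.
exists (conj_op x^-1%g) => y; rewrite /conj_op ?invgK !mulgA.
  by rewrite mulVg mul1g -mulgA mulVg mulg1.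
by rewrite mulgV mul1g -mulgA mulgV mulg1.
Qed.

Lemma conj_op_distr (G : groupType) (x y z : G) :
  conj_op x (conj_op y z) = conj_op (conj_op x y) (conj_op x z).
Proof. by rewrite /conj_op !invgM !invgK !mulgA !mulgVK. Qed.

Definition Conj (G : groupType) : rack :=
  Rack (@conj_op_bij G) (@conj_op_distr G).

Definition rface0 (X : rack) (n : nat) (i : 'I_n.+1) (x : fpow X n.+1) :
    fpow X n :=
  [ffun j : 'I_n => if (j < i)%N then x (lift i j) else x i |> x (lift i j)].

Definition rface1 (X : rack) (n : nat) (i : 'I_n.+1) (x : fpow X n.+1) :
    fpow X n :=
  [ffun j : 'I_n => x (lift i j)].

(* The sign is (-1)^(i+1) because the ordinal i stands for the index i+1.     *)
Definition rack_codiff (X : rack) (A : zmodType) (n : nat)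
    (f : fpow X n -> A) : fpow X n.+1 -> A :=
  \sum_(i < n.+1) ((f \o rface0 i) - (f \o rface1 i)) *~ (-1) ^+ i.+1.

Lemma subrBACA (A : zmodType) (a b c d : A) :
  (a - b) - (c - d) = (a - c) - (b - d).
Proof. by rewrite !opprD !opprK addrACA. Qed.

Lemma rack_codiffE (X : rack) (A : zmodType) n (f : fpow X n -> A) x :
  rack_codiff f x =
  \sum_(i < n.+1) (f (rface0 i x) - f (rface1 i x)) *~ (-1) ^+ i.+1.
Proof. by rewrite /rack_codiff sumfE; apply: eq_bigr => i _; rewrite mulrzfE. Qed.

Lemma rack_codiff_zmod (X : rack) (A : zmodType) n :
  zmod_morphism (@rack_codiff X A n).
Proof.
move=> f g; apply/funext => x.
rewrite [RHS]/= -[RHS]/(rack_codiff f x - rack_codiff g x) !rack_codiffE.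
rewrite -sumrB; apply: eq_bigr => i _; rewrite -mulrzBl; congr (_ *~ _).
exact: subrBACA.
Qed.

Section RackFaces.
Variables (X : rack) (n : nat) (i : 'I_n.+1) (j : 'I_n.+2).
Variables (i' : 'I_n.+2) (j' : 'I_n.+1) (x : fpow X n.+2).
Hypotheses (ij : (i < j)%N) (ii' : i = i' :> nat) (jj' : j.-1 = j' :> nat).

Lemma rface11 : rface1 i (rface1 j x) = rface1 j' (rface1 i' x).
Proof.
apply/ffunP => k; rewrite !ffunE; apply: ffun_eqval => /=; rewrite /bump; lia.
Qed.

Lemma rface10 : rface1 i (rface0 j x) = rface0 j' (rface1 i' x).
Proof.
apply/ffunP => k; rewrite !ffunE /=.
have -> : x (lift j (lift i k)) = x (lift i' (lift j' k)).
  by apply: ffun_eqval => /=; rewrite /bump; lia.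
have -> : x (lift i' j') = x j by apply: ffun_eqval => /=; rewrite /bump; lia.
by congr (if _ then _ else _); rewrite /bump; lia.
Qed.

Lemma rface01 : rface0 i (rface1 j x) = rface1 j' (rface0 i' x).
Proof.
apply/ffunP => k; rewrite !ffunE /=.
have -> : x (lift j (lift i k)) = x (lift i' (lift j' k)).
  by apply: ffun_eqval => /=; rewrite /bump; lia.
have -> : x (lift j i) = x i' by apply: ffun_eqval => /=; rewrite /bump; lia.
by congr (if _ then _ else _); rewrite /bump; lia.
Qed.

Lemma rface00 : rface0 i (rface0 j x) = rface0 j' (rface0 i' x).
Proof.
apply/ffunP => k; rewrite !ffunE /=.
have -> : x (lift j (lift i k)) = x (lift i' (lift j' k)).
  by apply: ffun_eqval => /=; rewrite /bump; lia.
have -> : x (lift j i) = x i' by apply: ffun_eqval => /=; rewrite /bump; lia.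
have -> : x (lift i' j') = x j by apply: ffun_eqval => /=; rewrite /bump; lia.
rewrite ij; have -> : (j' < i')%N = false by lia.
have -> : (bump j' k < i')%N = (k < i)%N by rewrite /bump; lia.
have -> : (bump i k < j)%N = (k < j')%N by rewrite /bump; lia.
case: ifP => ki; case: ifP => kj //; first by lia.
by rewrite rack_op_distr.
Qed.

End RackFaces.

Lemma rack_codiffK (X : rack) (A : zmodType) n (f : fpow X n -> A) :
  rack_codiff (rack_codiff f) = 0.
Proof.
apply/funext => x; rewrite rack_codiffE.
pose a j i : A :=
  let i := inord i : 'I_n.+1 in let j := inord j : 'I_n.+2 in
  (f (rface0 i (rface0 j x)) - f (rface1 i (rface0 j x)))
  - (f (rface0 i (rface1 j x)) - f (rface1 i (rface1 j x))).
rewrite -[RHS](@alt_sum_eq0 A n.+1 a).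
  apply: eq_bigr => j _; rewrite !rack_codiffE -sumrB mulrz_suml.
  apply: eq_bigr => i _; rewrite /a !inord_val -mulrzBl -mulrzA -exprD.
  by rewrite addnS addSn !exprS !mulN1r opprK.
move=> i j ij jn; rewrite /a.
have I1 : (inord i : 'I_n.+1) = i :> nat by rewrite inordK //; lia.
have I2 : (inord i : 'I_n.+2) = i :> nat by rewrite inordK //; lia.
have J1 : (inord j : 'I_n.+2) = j :> nat by rewrite inordK //; lia.
have J2 : (inord j.-1 : 'I_n.+1) = j.-1 :> nat by rewrite inordK //; lia.
have e0 : ((inord i : 'I_n.+1) < (inord j : 'I_n.+2))%N by lia.
have e1 : (inord i : 'I_n.+1) = (inord i : 'I_n.+2) :> nat by lia.
have e2 : (inord j : 'I_n.+2).-1 = (inord j.-1 : 'I_n.+1) :> nat by lia.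
rewrite (rface00 _ e0 e1 e2) (rface01 _ e0 e1 e2) (rface10 _ e0 e1 e2).
by rewrite (rface11 _ e0 e1 e2) subrBACA.
Qed.

Definition rack_complex (X : rack) (A : zmodType) : cochain_complex :=
  @CochainComplex (fun n => (fpow X n -> A) : zmodType)
    (@rack_codiff X A) (@rack_codiff_zmod X A) (@rack_codiffK X A).

Record trunk := Trunk {
  tvert : Type;
  tedge : Type;
  tsrc : tedge -> tvert;
  ttgt : tedge -> tvert;
  tpref : tedge -> tedge -> tedge -> tedge -> Prop;
  tpref_square : forall a b c d, tpref a b c d ->
    [/\ tsrc a = tsrc c, ttgt a = tsrc b, ttgt c = tsrc d & ttgt b = ttgt d]
}.
Arguments tsrc {t}.
Arguments ttgt {t}.
Arguments tpref {t}.

Record trunk_map (T U : trunk) := TrunkMap {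
  tm_vert : tvert T -> tvert U;
  tm_edge :> tedge T -> tedge U;
  tm_src : forall e, tsrc (tm_edge e) = tm_vert (tsrc e);
  tm_tgt : forall e, ttgt (tm_edge e) = tm_vert (ttgt e);
  tm_pref : forall a b c d, tpref a b c d ->
    tpref (tm_edge a) (tm_edge b) (tm_edge c) (tm_edge d)
}.

Lemma trunk_map_eq (T U : trunk) (F F' : trunk_map T U) :
  tm_vert F =1 tm_vert F' -> tm_edge F =1 tm_edge F' -> F = F'.
Proof.
case: F => v e h1 h2 h3; case: F' => v' e' h1' h2' h3' /= /funext ev /funext ee.
by subst v' e'; congr TrunkMap; apply: Prop_irrelevance.
Qed.

Definition trunk_comp (T U V : trunk) (K : trunk_map U V) (F : trunk_map T U) :
  trunk_map T V.
Proof.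
apply: (@TrunkMap T V (tm_vert K \o tm_vert F) (tm_edge K \o tm_edge F)).
- by move=> e /=; rewrite tm_src tm_src.
- by move=> e /=; rewrite tm_tgt tm_tgt.
- by move=> a b c d abcd; do 2!apply: tm_pref.
Defined.

(* The pair (A, k), with k outside A, is the edge from A to k |: A.           *)
Definition cube_edge (n : nat) :=
  {e : {set 'I_n} * 'I_n | e.2 \notin e.1}.

Definition cube_pref (n : nat) (a b c d : cube_edge n) : Prop :=
  exists (A : {set 'I_n}) (k l : 'I_n),
    [/\ (k < l)%N, k \notin A & l \notin A] /\
    [/\ val a = (A, k), val b = (k |: A, l),
        val c = (A, l) & val d = (l |: A, k)].

Definition cube (n : nat) : trunk.
Proof.
apply: (@Trunk {set 'I_n} (cube_edge n) (fun e => (val e).1)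
  (fun e => (val e).2 |: (val e).1) (@cube_pref n)).
abstract (move=> a b c d [A [k [l [_ [-> -> -> ->]]]]] /=; split=> //;
  exact: setUCA).
Defined.

Definition trunk_of_rack (X : rack) : trunk :=
  @Trunk unit X (fun=> tt) (fun=> tt)
    (fun a b c d : X => c = a |> b /\ d = a)
    (fun _ _ _ _ _ => And4 erefl erefl erefl erefl).

Definition trunk_of_group (G : groupType) : trunk :=
  @Trunk unit G (fun=> tt) (fun=> tt)
    (fun a b c d : G => (a * b = c * d)%g)
    (fun _ _ _ _ _ => And4 erefl erefl erefl erefl).

Definition inc (G : groupType) :
  trunk_map (trunk_of_rack (Conj G)) (trunk_of_group G).
Proof.
apply: (@TrunkMap (trunk_of_rack (Conj G)) (trunk_of_group G) id id) => //.
abstract (by move=> a b c d [-> ->]; rewrite /= /conj_op mulgVK).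
Defined.

Definition inc_push (G : groupType) (n : nat) :
    trunk_map (cube n) (trunk_of_rack (Conj G)) ->
    trunk_map (cube n) (trunk_of_group G) :=
  trunk_comp (inc G).

Definition initial_edge (n : nat) (k : 'I_n) : cube_edge n.
Proof.
apply: (exist _ ([set j : 'I_n | (j < k)%N], k)).
abstract (by rewrite /= inE ltnn).
Defined.

Definition eta (X : rack) (n : nat)
    (F : trunk_map (cube n) (trunk_of_rack X)) : fpow X n :=
  [ffun k => F (initial_edge k)].

Definition missing (n : nat) (A : {set 'I_n}) (k : 'I_n) : seq 'I_n :=
  [seq j : 'I_n <- enum 'I_n | (j < k)%N && (j \notin A)].

(* The value at A -> k |: A is x_k1 |> (x_k2 |> ... (x_km |> x_k)), where      *)
(* k1 < ... < km are the elements below k that are missing from A.            *)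
Definition eta_inv_edge (X : rack) (n : nat) (x : fpow X n) (e : cube_edge n) : X :=
  foldr (fun (j : 'I_n) y => x j |> y) (x (val e).2)
    (missing (val e).1 (val e).2).

Lemma foldr_rack_op (X : rack) (I : Type) (x : I -> X) (s : seq I) (y z : X) :
  foldr (fun j y => x j |> y) (y |> z) s =
  foldr (fun j y => x j |> y) y s |> foldr (fun j y => x j |> y) z s.
Proof. by elim: s => //= j s ->; rewrite rack_op_distr. Qed.

Lemma enum_ord_split n (k : 'I_n) : exists r1 r2,
  [/\ enum 'I_n = r1 ++ k :: r2, forall j, j \in r1 -> (j < k)%N
    & forall j, j \in r2 -> (k < j)%N].
Proof.
have srt : sorted (relpre (@nat_of_ord n) ltn) (enum 'I_n).
  by rewrite -sorted_map val_enum_ord iota_ltn_sorted.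
case/splitPr: (mem_enum 'I_n k) srt => r1 r2.
rewrite sorted_pairwise; last by move=> ? ? ?; apply: ltn_trans.
rewrite pairwise_cat /= => /and3P[/allrelP r12 _ /andP[/allP kr2 _]].
exists r1, r2; split=> // j jr.
by apply: r12; rewrite // mem_head.
Qed.

Lemma missing_split n (A : {set 'I_n}) (k l : 'I_n) :
  (k < l)%N -> k \notin A -> exists t,
    missing A l = missing A k ++ k :: t /\
    missing (k |: A) l = missing A k ++ t.
Proof.
move=> kl kA; have [r1 [r2 [E r1P r2P]]] := enum_ord_split k.
exists [seq j : 'I_n <- r2 | (j < l)%N && (j \notin A)].
have nil_r2 : [seq j : 'I_n <- r2 | (j < k)%N && (j \notin A)] = [::].
  rewrite (eq_in_filter (a2 := pred0)) ?filter_pred0 // => j /r2P kj /=.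
  by rewrite ltnNge (ltnW kj).
rewrite /missing E !filter_cat /= ltnn kl kA setU11 /= nil_r2 cats0.
split; congr (_ ++ _); last 1 first.
- apply: eq_in_filter => j /r2P kj; rewrite in_setU1 negb_or.
  by have -> : j != k by rewrite neq_ltn kj orbT.
- by apply: eq_in_filter => j /r1P jk; rewrite jk (ltn_trans jk kl).
- apply: eq_in_filter => j /r1P jk; rewrite jk (ltn_trans jk kl) in_setU1 negb_or.
  by have -> : j != k by rewrite neq_ltn jk.
Qed.

Lemma missing_setU1 n (A : {set 'I_n}) (k l : 'I_n) :
  (k < l)%N -> missing (l |: A) k = missing A k.
Proof.
move=> kl; apply: eq_filter => j; rewrite in_setU1 negb_or.
case jk: (j < k)%N => //=.
by have -> : j != l by rewrite neq_ltn (ltn_trans jk kl).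
Qed.

Definition eta_inv (X : rack) (n : nat) (x : fpow X n) :
  trunk_map (cube n) (trunk_of_rack X).
Proof.
apply: (@TrunkMap (cube n) (trunk_of_rack X) (fun=> tt) (eta_inv_edge x)) => //.
abstract (
move=> a b c d [A [k [l [[kl kA _] [Ea Eb Ec Ed]]]]];
rewrite /= /eta_inv_edge Ea Eb Ec Ed /= (missing_setU1 _ kl);
have [t [-> ->]] := missing_split kl kA;
by rewrite !foldr_cat /= foldr_rack_op).
Defined.

Lemma eta_invK (X : rack) n : cancel (@eta_inv X n) (@eta X n).
Proof.
move=> x; apply/ffunP => k; rewrite ffunE /= /eta_inv_edge /= /missing.
rewrite (eq_filter (a2 := pred0)) ?filter_pred0 // => j.
by rewrite inE; case: (j < k)%N.
Qed.

Lemma eta_inj (X : rack) n : injective (@eta X n).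
Proof.
move=> F F' FF'; apply: trunk_map_eq => [A|]; first by do 2!case: (tm_vert _ _).
have init (e e' : cube_edge n) (H : trunk_map (cube n) (trunk_of_rack X)) :
    (val e).2 = (val e').2 -> (val e').1 = [set j : 'I_n in (val e).1 | (j < (val e).2)%N] ->
    H e = H e'.
  elim: {e}_.+1 {-2}e (ltnSn #|(val e).1|) e' => // m IH e em e' e2 e1.
  case: (pickP [pred j : 'I_n | (j \in (val e).1) && ((val e).2 < j)%N]) => [l|noj].
    move=> /andP[/= lA kl].
    pose A := (val e).1 :\ l; pose k := (val e).2.
    have eA : (val e).1 = l |: A by rewrite /A setD1K.
    have kA : k \notin A.
      by rewrite /A in_setD1 negb_and; apply/orP; right; apply: (valP e).
    have lnA : l \notin A by rewrite /A setD11.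
    have klA : l \notin k |: A.
      by rewrite in_setU1 negb_or lnA andbT neq_ltn kl orbT.
    pose a : cube_edge n := exist _ (A, k) kA.
    pose b : cube_edge n := exist _ (k |: A, l) klA.
    pose c : cube_edge n := exist _ (A, l) lnA.
    have sq : tpref (t := cube n) a b c e.
      by exists A, k, l; do !split=> //; rewrite -eA; apply: surjective_pairing.
    have [_ ->] := tm_pref H sq.
    apply: IH => //=.
      by move: em; rewrite (cardsD1 l (val e).1) lA add1n ltnS.
    rewrite e1 /A; apply/setP => j; rewrite !inE.
    case: eqP => // -> /=; rewrite lA /=; apply/negbTE.
    by rewrite -leqNgt ltnW.
  congr (tm_edge H _); apply: val_inj; move: e1 e2 noj (valP e).
  rewrite /=; case: (val e) => A k; case: (val e') => A' k' /= -> -> noj kA.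
  congr (_, _); apply/setP => j; rewrite !inE.
  case jA: (j \in A) => //=; symmetry.
  have := noj j; rewrite /= jA /=; case: ltngtP => // jk _.
  by rewrite (val_inj jk) jA in kA.
rewrite /= => e; pose ms (e : cube_edge n) := missing (val e).1 (val e).2.
have msE (e' : cube_edge n) (i : 'I_n) :
    (i \in ms e') = (i < (val e').2)%N && (i \notin (val e').1).
  by rewrite mem_filter mem_enum andbT.
have [m] := ubnP #|ms e|; elim: m e => // m IH e em.
pose A := (val e).1; pose k := (val e).2.
case: (pickP [pred j : 'I_n | (j < k)%N && (j \notin A)]) => [j|noj].
  move=> /andP[/= jk jA].
  have kA : k \notin A by apply: (valP e).
  have jkA : k \notin j |: A.
    by rewrite in_setU1 negb_or kA andbT neq_ltn jk orbT.
  have kjA : j \notin k |: A.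
    by rewrite in_setU1 negb_or jA andbT neq_ltn jk.
  pose a : cube_edge n := exist _ (A, j) jA.
  pose b : cube_edge n := exist _ (j |: A, k) jkA.
  pose d : cube_edge n := exist _ (k |: A, j) kjA.
  have sq : tpref (t := cube n) a b e d.
    by exists A, j, k; do !split=> //; apply: surjective_pairing.
  have [-> _] := tm_pref F sq; have [-> _] := tm_pref F' sq.
  congr (_ |> _); apply: IH; move: em; rewrite ltnS; apply: leq_trans.
    apply: proper_card; apply/properP; split.
      apply/subsetP => i; rewrite !msE /= => /andP[ij ->].
      by rewrite (ltn_trans ij jk).
    by exists j; rewrite !msE /= ?ltnn //; apply/andP.
  apply: proper_card; apply/properP; split.
    apply/subsetP => i; rewrite !msE /= in_setU1 negb_or.
    by move=> /andP[-> /andP[_ ->]].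
  by exists j; rewrite !msE /= ?setU11 ?andbF //; apply/andP.
have := congr1 (fun x : fpow X n => x k) FF'; rewrite !ffunE.
have e1 : (val (initial_edge k)).1 = [set j : 'I_n in (val e).1 | (j < (val e).2)%N].
  apply/setP => j; rewrite !inE; have := noj j; rewrite /= -/A -/k.
  by case: (j < k)%N; case: (j \in A).
by rewrite -!(init e (initial_edge k)).
Qed.

Lemma etaK (X : rack) n : cancel (@eta X n) (@eta_inv X n).
Proof. by move=> F; apply: (@eta_inj X n); rewrite eta_invK. Qed.

(* Diagrammatic order: [ccomp f g] is f followed by g. *)
Record category := Category {
  cobj :> Type;
  chom : cobj -> cobj -> Type;
  cid : forall x, chom x x;
  ccomp : forall x y z, chom x y -> chom y z -> chom x z;
  ccomp_idl : forall x y (f : chom x y), ccomp (cid x) f = f;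
  ccomp_idr : forall x y (f : chom x y), ccomp f (cid y) = f;
  ccompA : forall x y z t (f : chom x y) (g : chom y z) (h : chom z t),
    ccomp f (ccomp g h) = ccomp (ccomp f g) h
}.
Arguments chom {c}.
Arguments cid {c}.
Arguments ccomp {c x y z}.

Record functor (C D : category) := Functor {
  fobj :> C -> D;
  fmap : forall x y : C, chom x y -> chom (fobj x) (fobj y);
  fmap_id : forall x, fmap (cid x) = cid (fobj x);
  fmap_comp : forall x y z (f : chom x y) (g : chom y z),
    fmap (ccomp f g) = ccomp (fmap f) (fmap g)
}.
Arguments fmap {C D} F {x y} _ : rename.

Definition functor_comp (C D E : category) (K : functor D E) (F : functor C D) :
  functor C E.
Proof.
apply: (@Functor C E (K \o F) (fun x y f => fmap K (fmap F f))).
- abstract (by move=> x; rewrite !fmap_id).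
- abstract (by move=> x y z f g; rewrite !fmap_comp).
Defined.

Definition preorder_cat (T : Type) (le : rel T) (le_refl : reflexive le)
  (le_trans : transitive le) : category.
Proof.
apply: (@Category T (fun x y => is_true (le x y)) le_refl
  (fun x y z xy yz => le_trans y x z xy yz)); move=> *; exact: bool_irrelevance.
Defined.

Definition subset_rel (n : nat) : rel {set 'I_n} := fun A B => A \subset B.

Definition cube_cat (n : nat) : category :=
  @preorder_cat {set 'I_n} (@subset_rel n) (fun A => subxx A)
    (fun B A C => @subset_trans _ A B C).

Definition simplex_cat (n : nat) : category :=
  @preorder_cat 'I_n.+1 (fun i j => (i <= j)%N) (fun i => leqnn i)
    (fun j i k => @leq_trans j i k).

Definition group_cat (G : groupType) : category :=
  @Category unit (fun _ _ => G) (fun=> 1%g) (fun _ _ _ a b => (a * b)%g)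
    (fun _ _ => @mul1g G) (fun _ _ => @mulg1 G) (fun _ _ _ _ => @mulgA G).

(* The value at A -> k |: A; it is 1 when k lies in A.                        *)
Definition edge_val (G : groupType) (n : nat)
    (F : trunk_map (cube n) (trunk_of_group G)) (A : {set 'I_n}) (k : 'I_n) : G :=
  oapp (tm_edge F) 1%g (insub (A, k)).

Fixpoint path_val (G : groupType) (n : nat)
    (F : trunk_map (cube n) (trunk_of_group G)) (A : {set 'I_n})
    (s : seq 'I_n) : G :=
  if s is k :: s' then (edge_val F A k * path_val F (k |: A) s')%g else 1%g.

Lemma edge_valE (G : groupType) n (F : trunk_map (cube n) (trunk_of_group G))
  (e : cube_edge n) : edge_val F (val e).1 (val e).2 = F e.
Proof. by rewrite /edge_val -surjective_pairing valK. Qed.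

Lemma edge_val_swap (G : groupType) n (F : trunk_map (cube n) (trunk_of_group G))
  (A : {set 'I_n}) (k l : 'I_n) : k != l -> k \notin A -> l \notin A ->
  (edge_val F A k * edge_val F (k |: A) l =
   edge_val F A l * edge_val F (l |: A) k)%g.
Proof.
wlog kl : k l / (k < l)%N => [W neq_kl kA lA|_ kA lA].
  case: (ltngtP k l) neq_kl => [kl|lk|/val_inj ->]; rewrite ?eqxx // => neq_kl.
    exact: W.
  by symmetry; apply: W; rewrite // eq_sym.
have lkA : l \notin k |: A by rewrite in_setU1 negb_or lA andbT neq_ltn kl orbT.
have klA : k \notin l |: A by rewrite in_setU1 negb_or kA andbT neq_ltn kl.
pose a : cube_edge n := exist _ (A, k) kA.
pose b : cube_edge n := exist _ (k |: A, l) lkA.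
pose c : cube_edge n := exist _ (A, l) lA.
pose d : cube_edge n := exist _ (l |: A, k) klA.
have sq : tpref (t := cube n) a b c d by exists A, k, l.
have /= := tm_pref F sq.
by rewrite -(edge_valE F a) -(edge_valE F b) -(edge_valE F c) -(edge_valE F d).
Qed.

Lemma path_val_cat (G : groupType) n (F : trunk_map (cube n) (trunk_of_group G))
  (A : {set 'I_n}) (s t : seq 'I_n) :
  path_val F A (s ++ t) = (path_val F A s * path_val F (A :|: [set:: s]) t)%g.
Proof.
elim: s A => [|k s IH] A /=.
  by rewrite mul1g; congr path_val; apply/setP => j; rewrite !inE orbF.
rewrite IH mulgA; congr (_ * path_val _ _ _)%g.
by apply/setP => j; rewrite !inE orbA (orbC (j == k)).
Qed.

Lemma path_val_front (G : groupType) n (F : trunk_map (cube n) (trunk_of_group G))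
  (A : {set 'I_n}) (k : 'I_n) (s t : seq 'I_n) :
  uniq (k :: s) -> k \notin A -> (forall j, j \in s -> j \notin A) ->
  path_val F A (s ++ k :: t) = path_val F A (k :: s ++ t).
Proof.
elim: s A => //= j s IH A.
rewrite inE negb_or => /andP[/andP[kj ks] /andP[js us]] kA sA.
have jA : j \notin A by apply: sA; rewrite mem_head.
rewrite IH /= ?ks //; first last.
- move=> i si; rewrite in_setU1 negb_or sA ?inE ?si ?orbT // andbT.
  by apply: contraNneq js => <-.
- by rewrite in_setU1 negb_or kj.
by rewrite !mulgA edge_val_swap // 1?eq_sym // setUCA.
Qed.

Lemma path_val_perm (G : groupType) n (F : trunk_map (cube n) (trunk_of_group G))
  (A : {set 'I_n}) (s t : seq 'I_n) :
  uniq s -> (forall j, j \in s -> j \notin A) -> perm_eq s t ->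
  path_val F A s = path_val F A t.
Proof.
elim: s A t => [|k s IH] A t us sA pst.
  by have /perm_nilP -> : perm_eq t [::] by rewrite perm_sym.
have kt : k \in t by rewrite -(perm_mem pst) mem_head.
have ut : uniq t by rewrite -(perm_uniq pst).
have tA j : j \in t -> j \notin A by rewrite -(perm_mem pst); apply: sA.
case/splitPr: kt => t1 t2 in pst ut tA *.
have pk : perm_eq (t1 ++ k :: t2) (k :: t1 ++ t2).
  exact/permPl/(perm_catCA t1 [:: k] t2).
have uk : uniq (k :: t1 ++ t2) by rewrite -(perm_uniq pk).
rewrite path_val_front; first last.
- by move=> j jt; apply: tA; rewrite mem_cat jt.
- by apply: sA; rewrite mem_head.
- by move: uk; rewrite -cat_cons cat_uniq => /and3P[].
move: us => /= /andP[ks us]; congr (_ * _)%g; apply: IH => //.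
  move=> j js; rewrite in_setU1 negb_or sA ?inE ?js ?orbT // andbT.
  by apply: contraNneq ks => <-.
by rewrite -(perm_cons k); apply: perm_trans pst pk.
Qed.

Lemma path_val_comp (G : groupType) n (F : trunk_map (cube n) (trunk_of_group G))
  (A B C : {set 'I_n}) : A \subset B -> B \subset C ->
  path_val F A (enum (C :\: A)) =
  (path_val F A (enum (B :\: A)) * path_val F B (enum (C :\: B)))%g.
Proof.
move=> AB BC; rewrite (@path_val_perm _ _ _ _ _ (enum (B :\: A) ++ enum (C :\: B))).
- rewrite path_val_cat; congr (_ * path_val _ _ _)%g.
  apply/setP => j; rewrite !inE mem_enum !inE.
  by case jA: (j \in A) => //=; rewrite (subsetP AB _ jA).
- exact: enum_uniq.
- by move=> j; rewrite mem_enum inE => /andP[].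
apply: uniq_perm; rewrite ?enum_uniq ?cat_uniq ?enum_uniq //=.
  rewrite andbT; apply/hasPn => j; rewrite !mem_enum !inE.
  by case: (j \in B); rewrite ?andbF.
move=> j; rewrite mem_cat !mem_enum !inE.
have := subsetP AB j; have := subsetP BC j.
case: (j \in A); case: (j \in B); case: (j \in C) => //= h1 h2;
  by [have := h1 isT | have := h2 isT].
Qed.

Definition theta (G : groupType) (n : nat)
    (F : trunk_map (cube n) (trunk_of_group G)) :
  functor (cube_cat n) (group_cat G).
Proof.
apply: (@Functor (cube_cat n) (group_cat G) (fun=> tt)
  (fun A B _ => path_val F A (enum (B :\: A)))).
- abstract (by move=> A /=; rewrite setDv enum_set0).
- abstract (by move=> A B C AB BC /=; apply: path_val_comp).
Defined.

Definition cube_step (n : nat) (e : cube_edge n) :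
  chom (c := cube_cat n) (val e).1 ((val e).2 |: (val e).1) :=
  subsetUr [set (val e).2] (val e).1.

Lemma theta_edge (G : groupType) n (F : trunk_map (cube n) (trunk_of_group G))
  (e : cube_edge n) : fmap (theta F) (cube_step e) = F e.
Proof.
rewrite -edge_valE; case: e => -[A k] /= kA.
have -> : (k |: A) :\: A = [set k].
  apply/setP => j; rewrite !inE; case: eqP => [->|]; first by rewrite kA.
  by case: (j \in A).
by rewrite enum_set1 /= mulg1.
Qed.

Lemma theta_uniq (G : groupType) n (F : trunk_map (cube n) (trunk_of_group G))
  (K : functor (cube_cat n) (group_cat G)) :
  (forall e, fmap K (cube_step e) = F e) -> K = theta F.
Proof.
move=> KF.
have fE A B (AB : chom (c := cube_cat n) A B) : fmap K AB = fmap (theta F) AB.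
  have [m] := ubnP #|B :\: A|; elim: m A AB => // m IH A AB lem.
  case: (set_0Vmem (B :\: A)) => [BA0|[k]].
    have eAB : A = B.
      by apply/eqP; rewrite eqEsubset [A \subset B]AB -setD_eq0 BA0 eqxx.
    subst B; have -> : AB = cid A by apply: bool_irrelevance.
    by rewrite !fmap_id.
  rewrite inE => /andP[kA kB].
  pose e : cube_edge n := exist _ (A, k) kA.
  have kAB : chom (c := cube_cat n) (k |: A) B.
    by rewrite /= /subset_rel subUset sub1set kB.
  have -> : AB = ccomp (cube_step e) kAB by apply: bool_irrelevance.
  rewrite [LHS]fmap_comp [RHS]fmap_comp.
  have -> : fmap K (cube_step e) = fmap (theta F) (cube_step e) :> G.
    by rewrite KF theta_edge.
  congr ccomp; apply: IH.
  move: lem; rewrite (cardsD1 k) !inE kA kB add1n ltnS; congr (_ < _)%N.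
  by congr #|pred_of_set _|; apply/setP => j; rewrite !inE; case: eqP.
case: K {KF} fE => o f fid fc /= fE; rewrite /theta.
have eo : o = fun=> tt by apply/funext => A; case: (o A).
subst o; have ef : f = fun A B _ => path_val F A (enum (B :\: A)).
  by do 3!apply: functional_extensionality_dep => ?; apply: fE.
by subst f; congr Functor; apply: Prop_irrelevance.
Qed.

Lemma perm_chain_subset n (s : 'S_n) (i j : 'I_n.+1) : (i <= j)%N ->
  [set s k | k : 'I_n & (k < i)%N] \subset [set s k | k : 'I_n & (k < j)%N].
Proof.
move=> ij; apply: imsetS; apply/subsetP => k.
by rewrite !inE => /leq_trans; apply.
Qed.

Definition perm_functor (n : nat) (s : 'S_n) :
  functor (simplex_cat n) (cube_cat n).
Proof.
apply: (@Functor (simplex_cat n) (cube_cat n)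
  (fun i : 'I_n.+1 => [set s k | k : 'I_n & (k < i)%N]) (@perm_chain_subset n s));
abstract (by move=> *; apply: bool_irrelevance).
Defined.

Definition pullback (G : groupType) (n : nat) (s : 'S_n)
    (K : functor (cube_cat n) (group_cat G)) :
    functor (simplex_cat n) (group_cat G) :=
  functor_comp K (perm_functor s).

Definition simplex_step (n : nat) (k : 'I_n) :
    chom (c := simplex_cat n) (widen_ord (leqnSn n) k) (lift ord0 k) :=
  leqnSn k.

Definition lambda (G : groupType) (n : nat)
    (K : functor (simplex_cat n) (group_cat G)) : fpow G n :=
  [ffun k => fmap K (simplex_step k)].

Definition antisym (G : groupType) (A : zmodType) (n : nat)
    (f : group_complex G A n) : rack_complex (Conj G) A n :=
  \sum_(s : 'S_n)
    (f \o @lambda G n \o pullback s \o @theta G n \o @inc_push G n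
       \o @eta_inv (Conj G) n) *~ (-1) ^+ s.

(* Main.v *)
Require Import Defs.
From HB Require Import structures.
From mathcomp Require Import all_boot all_order all_algebra all_fingroup.
From mathcomp Require Import boolp functions.
From mathcomp Require Import zify.

(** A permutation [s] of the n coordinates traces a maximal chain of subsets of
    the cube, and the edge labels of [x] along that chain form a tuple
    [chain_val s x]; the antisymmetrization of [f] at [x] is the signed sum of
    the [f (chain_val s x)] ([antisymE]).  Compatibility with the differentials
    is then the cubical counterpart of the decomposition of the boundary of a
    triangulated cube:

    - an inner face multiplies two consecutive labels.  The chains of [s] and
      of the product of [s] with the adjacent transposition bound a common
      square, on which the label products agree; the two terms have opposite
      signs and cancel ([gface_chain_val_tperm], [sum_sign_odd_invariant]);
    - face 0 forgets the first step.  If that step adds [k], what remains is a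
      chain in the facet of sets containing [k], whose labels are those of [x]
      with [x k] deleted ([gface0_chain_val]);
    - the last face forgets the last step.  If that step adds [k], what remains
      is a chain in the facet of sets avoiding [k]; by self-distributivity its
      labels are those of [x] with [x k] deleted and acting on the coordinates
      after it ([gface_max_chain_val]).

    Sorting the permutations by the value [k] taken at the first or the last
    position ([sum_perm_lift]) turns the two outer faces into the two families
    of faces of the rack differential. *)

Set Implicit Arguments.
Unset Strict Implicit.
Unset Printing Implicit Defensive.

Import GRing.Theory.
Local Open Scope ring_scope.
Local Open Scope rack_scope.

(** * Sums over permutations *)

Lemma sum_perm_lift (A : zmodType) n (i : 'I_n.+1) (F : 'S_n.+1 -> A) :
  \sum_(s : 'S_n.+1) F s = \sum_(k < n.+1) \sum_(s : 'S_n) F (lift_perm i k s).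
Proof.
pose h (p : 'I_n.+1 * 'S_n) := lift_perm i p.1 p.2.
have h_inj : injective h.
  move=> [k s] [l t] /permP hE; have := hE i; rewrite !lift_perm_id /= => kl.
  subst l; congr (_, _); apply/permP => j.
  by have := hE (lift i j); rewrite !lift_perm_lift /= => /lift_inj.
have h_bij : bijective h.
  by apply: inj_card_bij; rewrite // card_prod !card_Sn card_ord -factS.
by rewrite (reindex h) ?pair_big //; apply: onW_bij.
Qed.

(** The terms cancel in pairs, so no division by 2 is involved and [A] may have
    2-torsion. *)
Lemma sum_sign_odd_invariant (A : zmodType) n (t : 'S_n) (F : 'S_n -> A) :
  odd_perm t -> (forall s, F (t * s)%g = F s) ->
  \sum_(s : 'S_n) F s *~ (-1) ^+ s = 0.
Proof.
move=> todd Ft; rewrite (bigID (@odd_perm _)) /=.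
rewrite [X in _ + X](reindex_inj (mulgI t)) /= addrC -[X in X + _]opprK.
apply/eqP; rewrite addrC subr_eq0 -sumrN; apply/eqP.
apply: eq_big => s; first by rewrite odd_permM todd negbK.
by move=> sodd; rewrite Ft odd_permM todd sodd expr1 expr0 mulrNz.
Qed.

(** * Labels along the chain of a permutation *)

(** The i-th vertex of the chain of [s]: the values of [s] at the first [i]
    positions. *)
Definition prefix_set n (s : 'S_n) (i : nat) : {set 'I_n} :=
  [set s k | k : 'I_n & (k < i)%N].

Lemma mem_prefix_set n (s : 'S_n) i a :
  (a \in prefix_set s i) = (s^-1%g a < i)%N.
Proof.
apply/imsetP/idP => [[k + ->]|lt]; first by rewrite inE permK.
by exists (s^-1%g a); rewrite ?inE ?permKV.
Qed.

Lemma perm_notin_prefix_set n (s : 'S_n) (i : 'I_n) : s i \notin prefix_set s i.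
Proof. by rewrite mem_prefix_set permK ltnn. Qed.

(** The label that the cube map of [x] puts on the edge from [A] to [k |: A].
    The formula makes sense for all [A] and [k], also when [k] lies in [A]. *)
Definition cube_val (X : rack) n (x : 'I_n -> X) (A : {set 'I_n}) (k : 'I_n) : X :=
  foldr (fun j y => x j |> y) (x k) (missing A k).

(** The tuple of labels read along the chain of [s]. *)
Definition chain_val (X : rack) n (s : 'S_n) (x : fpow X n) : fpow X n :=
  [ffun i : 'I_n => cube_val x (prefix_set s i) (s i)].

Lemma edge_val_inc_push (G : groupType) n (x : fpow (Conj G) n)
    (A : {set 'I_n}) (k : 'I_n) : k \notin A ->
  edge_val (inc_push (eta_inv x)) A k = cube_val x A k.
Proof. by move=> kA; rewrite (edge_valE _ (exist _ (A, k) kA)). Qed.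

Lemma lambda_chain_val (G : groupType) n (s : 'S_n) (x : fpow (Conj G) n) :
  lambda (pullback s (theta (inc_push (eta_inv x)))) = chain_val s x.
Proof.
apply/ffunP => k; rewrite !ffunE.
pose e : cube_edge n := exist _ (prefix_set s k, s k) (perm_notin_prefix_set s k).
rewrite -edge_val_inc_push ?perm_notin_prefix_set //= /bump add1n.
rewrite -!/(prefix_set s _).
have -> : prefix_set s k.+1 :\: prefix_set s k = [set s k].
  apply/setP => a; rewrite inE !mem_prefix_set in_set1 ltnS -leqNgt.
  by rewrite -{3}(permKV s a) (inj_eq perm_inj) -val_eqE eqn_leq andbC.
by rewrite enum_set1 /= mulg1.
Qed.

Lemma antisymE (G : groupType) (A : zmodType) n (f : group_complex G A n) x :
  antisym f x = \sum_(s : 'S_n) f (chain_val s x) *~ (-1) ^+ s.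
Proof.
rewrite /antisym sumfE; apply: eq_bigr => s _.
by rewrite mulrzfE /= lambda_chain_val.
Qed.

Lemma antisym_zmod (G : groupType) (A : zmodType) n :
  zmod_morphism (@antisym G A n).
Proof.
move=> f g; apply/funext => x.
rewrite [RHS]/= -[RHS]/(antisym f x - antisym g x) !antisymE.
by rewrite -sumrB; apply: eq_bigr => s _; rewrite -mulrzBl.
Qed.

(** * Inner faces *)

Lemma gface_chain_val_tperm (G : groupType) n (s : 'S_n.+1) (x : fpow (Conj G) n.+1)
    (i : 'I_n) :
  gface i.+1 (chain_val (tperm (widen_ord (leqnSn n) i) (lift ord0 i) * s)%g x) =
  gface (G := G) i.+1 (chain_val s x).
Proof.
set p := widen_ord _ i; set q := lift ord0 i; set t := tperm p q.
have pq : p != q by rewrite -val_eqE /= /bump /=; lia.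
have pre (j : nat) : j != i.+1 -> prefix_set (t * s) j = prefix_set s j.
  move=> ji; apply/setP => a; rewrite !mem_prefix_set invMg tpermV permM.
  by case: tpermP => [->|->|//]; rewrite /= /bump; lia.
have preS (u : 'S_n.+1) : prefix_set u i.+1 = u p |: prefix_set u i.
  apply/setP => a; rewrite in_setU1 !mem_prefix_set.
  have -> : (a == u p) = (u^-1%g a == p).
    by rewrite -{1}(permKV u a) (inj_eq perm_inj).
  by rewrite ltnS leq_eqVlt.
have far (j : 'I_n.+1) : j != p -> j != q -> chain_val (t * s) x j = chain_val s x j.
  move=> jp jq; rewrite !ffunE permM tpermD 1?eq_sym // pre //.
apply/ffunP => j; rewrite [LHS]ffunE [RHS]ffunE; case: ifP => [ji|nji].
  by rewrite far // -val_eqE /= ?/bump; lia.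
case: ifP => [/eqP [/val_inj ->]|ji]; last first.
  by rewrite far // -val_eqE /= /bump; lia.
rewrite -/p -/q !ffunE !permM tpermL tpermR.
rewrite [nat_of_ord q]lift0 [nat_of_ord p]/= !preS permM tpermL pre; last by lia.
have pA : s p \notin prefix_set s i by rewrite mem_prefix_set permK /=; lia.
have qA : s q \notin prefix_set s i by rewrite mem_prefix_set permK /= /bump; lia.
have spq : s p != s q by rewrite (inj_eq perm_inj).
have pqA : s p \notin s q |: prefix_set s i by rewrite in_setU1 negb_or spq.
have qpA : s q \notin s p |: prefix_set s i by rewrite in_setU1 negb_or eq_sym spq.
rewrite -!edge_val_inc_push //; symmetry; exact: edge_val_swap.
Qed.

(** * Outer faces *)

Lemma missing_sorted n (A : {set 'I_n}) k :
  sorted (relpre (@nat_of_ord n) ltn) (missing A k).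
Proof.
apply: sorted_filter; first by move=> ? ? ?; apply: ltn_trans.
by rewrite -sorted_map val_enum_ord iota_ltn_sorted.
Qed.

Lemma mem_missing n (A : {set 'I_n}) k j :
  (j \in missing A k) = (j < k)%N && (j \notin A).
Proof. by rewrite mem_filter mem_enum andbT. Qed.

(** If [A] is obtained from [B] by renumbering around [k], the elements missing
    from [A] correspond to those missing from [B], unless [k] is one of them. *)
Lemma missing_lift n (k : 'I_n.+1) (A : {set 'I_n.+1}) (B : {set 'I_n}) (l : 'I_n) :
    (forall j, (lift k j \in A) = (j \in B)) -> (k < lift k l)%N ==> (k \in A) ->
  missing A (lift k l) = map (lift k) (missing B l).
Proof.
move=> AB kA; apply: (@irr_sorted_eq _ (relpre (@nat_of_ord n.+1) ltn)).
- by move=> ? ? ?; apply: ltn_trans.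
- by move=> ?; apply: ltnn.
- exact: missing_sorted.
- rewrite sorted_map; apply: sub_sorted (missing_sorted B l) => a b /=.
  by rewrite /bump; lia.
move=> j; rewrite mem_missing; case: (unliftP k j) => [j'|] ->.
  rewrite mem_map; last exact: lift_inj.
  by rewrite mem_missing AB /=; congr andb; rewrite /bump; lia.
apply/idP/mapP => [/andP[kl]|[j' _ /eqP]]; last by rewrite (negbTE (neq_lift _ _)).
by rewrite (implyP kA).
Qed.

Lemma foldr_map_eq (X : rack) (I J : eqType) (h : I -> J) (x : J -> X) (y : I -> X)
    (r : seq I) (u : X) : {in r, forall i, x (h i) = y i} ->
  foldr (fun j z => x j |> z) u (map h r) = foldr (fun i z => y i |> z) u r.
Proof.
elim: r => //= i r IH hr; rewrite hr ?mem_head // IH // => j jr.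
by rewrite hr // inE jr orbT.
Qed.

Lemma foldr_rack_op_distr (X : rack) (I : Type) (x : I -> X) (r : seq I) (a u : X) :
  a |> foldr (fun i z => x i |> z) u r =
  foldr (fun i z => (a |> x i) |> z) (a |> u) r.
Proof. by elim: r => //= i r <-; rewrite rack_op_distr. Qed.

(** Labels on the facet of the sets that contain [k]. *)
Lemma cube_val_rface1 (X : rack) n (x : fpow X n.+1) (k : 'I_n.+1)
    (A : {set 'I_n.+1}) (B : {set 'I_n}) (l : 'I_n) :
    (forall j, (lift k j \in A) = (j \in B)) -> k \in A ->
  cube_val x A (lift k l) = cube_val (rface1 k x) B l.
Proof.
move=> AB kA; rewrite /cube_val (missing_lift AB) ?kA ?implybT // ffunE.
by apply: foldr_map_eq => j _; rewrite ffunE.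
Qed.

(** Labels on the facet of the sets that avoid [k].  Below [k] nothing changes;
    above [k], the letter [x k] occurs among the acting letters, and
    self-distributivity moves it inwards past all the letters that follow it. *)
Lemma cube_val_rface0 (X : rack) n (x : fpow X n.+1) (k : 'I_n.+1)
    (A : {set 'I_n.+1}) (B : {set 'I_n}) (l : 'I_n) :
    (forall j, (lift k j \in A) = (j \in B)) -> k \notin A ->
  cube_val x A (lift k l) = cube_val (rface0 k x) B l.
Proof.
move=> AB kA; have [lk|kl] := ltnP l k.
  have mis : missing A (lift k l) = map (lift k) (missing B l).
    by apply: missing_lift => //=; rewrite /bump; lia.
  rewrite /cube_val mis ffunE lk; apply: foldr_map_eq => j.
  by rewrite mem_missing => /andP[jl _]; rewrite ffunE (ltn_trans jl lk).
have kl' : (k < lift k l)%N by rewrite /= /bump; lia.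
have [t [E1 E2]] := missing_split kl' kA.
have E3 : missing (k |: A) (lift k l) = map (lift k) (missing B l).
  apply: missing_lift => [j|]; last by rewrite setU11 implybT.
  by rewrite in_setU1 AB eq_sym (negbTE (neq_lift _ _)).
have tk j : j \in t -> (k < j)%N.
  have := missing_sorted A (lift k l); rewrite E1.
  rewrite sorted_pairwise; last by move=> ? ? ?; apply: ltn_trans.
  by rewrite pairwise_cat /= => /and3P[_ _ /andP[/allP + _]]; apply.
(* [y] is [rface0 k x] without the renumbering that skips [k]. *)
pose y (j : 'I_n.+1) := if (j < k)%N then x j else x k |> x j.
have yE j : rface0 k x j = y (lift k j).
  rewrite ffunE /y; congr (if _ then _ else _); rewrite /= /bump; lia.
have -> : cube_val (rface0 k x) B l =
    foldr (fun j z => y j |> z) (y (lift k l)) (map (lift k) (missing B l)).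
  by rewrite /cube_val yE; symmetry; apply: foldr_map_eq => j _; rewrite yE.
rewrite /cube_val -E3 E1 E2 !foldr_cat /= foldr_rack_op_distr.
have -> : y (lift k l) = x k |> x (lift k l) by rewrite /y ltnNge (ltnW kl').
have -> : foldr (fun j z => y j |> z) (x k |> x (lift k l)) t =
          foldr (fun j z => (x k |> x j) |> z) (x k |> x (lift k l)) t.
  rewrite -{1}(map_id t); apply: foldr_map_eq => j /tk kj.
  by rewrite /y ltnNge (ltnW kj).
rewrite -{1}(map_id (missing A k)); apply: foldr_map_eq => j.
by rewrite mem_missing => /andP[jk _]; rewrite /y jk.
Qed.

Lemma gface0_chain_val (G : groupType) n (k : 'I_n.+1) (s : 'S_n)
    (x : fpow (Conj G) n.+1) :
  gface (G := G) 0 (chain_val (lift_perm ord0 k s) x) = chain_val s (rface1 k x).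
Proof.
apply/ffunP => i; rewrite !ffunE /= lift_perm_lift.
apply: (@cube_val_rface1 (Conj G)).
  move=> j; rewrite !mem_prefix_set lift_permV lift_perm_lift /= /bump; lia.
by rewrite mem_prefix_set lift_permV lift_perm_id.
Qed.

Lemma gface_max_chain_val (G : groupType) n (k : 'I_n.+1) (s : 'S_n)
    (x : fpow (Conj G) n.+1) :
  gface (G := G) n.+1 (chain_val (lift_perm ord_max k s) x) =
  chain_val s (rface0 k x).
Proof.
apply/ffunP => i; rewrite !ffunE ltnS ltn_ord.
have -> : widen_ord (leqnSn n) i = lift ord_max i.
  by apply: val_inj; rewrite /= /bump; have := ltn_ord i; lia.
rewrite lift_perm_lift; apply: (@cube_val_rface0 (Conj G)).
  move=> j; rewrite !mem_prefix_set lift_permV lift_perm_lift lift_max.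
  by rewrite lift_max.
by rewrite mem_prefix_set lift_permV lift_perm_id lift_max -leqNgt ltnW.
Qed.

(** * Compatibility with the differentials *)

Lemma antisym_codiff (G : groupType) (A : zmodType) n (f : group_complex G A n) :
  antisym (codiff (group_complex G A) f) =
  codiff (rack_complex (Conj G) A) (antisym f).
Proof.
apply/funext => x; rewrite antisymE [RHS]rack_codiffE.
(* [T i] is the contribution of the i-th face of the group differential. *)
pose T i := (\sum_(s : 'S_n.+1) f (gface i (chain_val s x)) *~ (-1) ^+ s) *~ (-1) ^+ i.
transitivity (\sum_(i < n.+2) T i).
  under eq_bigr => s _ do rewrite [X in X *~ _]group_codiffE mulrz_suml.
  rewrite exchange_big; apply: eq_bigr => i _; rewrite /T mulrz_suml.
  by apply: eq_bigr => s _; rewrite -!mulrzA mulrC.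
rewrite big_ord_recl big_ord_recr /= big1 => [|i _]; last first.
  rewrite /T (@sum_sign_odd_invariant _ _
    (tperm (widen_ord (leqnSn n) i) (lift ord0 i))) ?mul0rz //.
    by rewrite odd_tperm -val_eqE /= /bump; lia.
  by move=> s; rewrite gface_chain_val_tperm.
rewrite add0r /T /= /bump /= add1n expr0 mulr1z (sum_perm_lift ord0) (sum_perm_lift ord_max).
rewrite mulrz_suml -big_split /=; apply: eq_bigr => k _.
rewrite !antisymE -sumrB !mulrz_suml -big_split /=; apply: eq_bigr => s _.
rewrite gface0_chain_val gface_max_chain_val !odd_lift_perm -mulrzBl -!mulrzA.
move: (odd_perm s) => e.
rewrite !signr_addb !signr_odd expr0 mul1r mulrzBl addrC -mulrNz.
have nn : (-1) ^+ n * (-1) ^+ n.+1 = -1 :> int.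
  by rewrite exprS mulrCA -expr2 sqrr_sign mulr1.
congr (_ *~ _ + _ *~ _); rewrite [in RHS]exprS.
  by rewrite [LHS]mulrAC [X in X * _]mulrAC nn mulrC.
by rewrite mulN1r mulrN opprK mulrC.
Qed.

Theorem theorem5p6 (G : groupType) (A : zmodType) :
  cochain_morphism (C := group_complex G A) (D := rack_complex (Conj G) A)
    (@antisym G A).
Proof. by split=> n; [apply: antisym_zmod | apply: antisym_codiff]. Qed.
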